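(* Let $H$ be a Hilbert space and let $E,A\in L(H)$ be bounded linear operators such that the pair $(E,A)$ is regular. Assume that $E[\mathrm{IV}_{\operatorname{ind}(E,A)}]\subseteq H$ is closed and let $u_0\in\mathrm{IV}_{\operatorname{ind}(E,A)+1}$. Then there exists a unique continuously differentiable function $u\colon\mathbb{R}_{>0}\to H$ with $u(0+)=u_0$ such that $$Eu'(t)+Au(t)=0\quad(t>0).$$
   Context: $H$ is a complex Hilbert space (possibly infinite-dimensional), $L(H)$ is the space of bounded linear operators on $H$, and $\mathbb{N}$ contains $0$. For $\nu_0\in\mathbb{R}$, $\mathbb{C}_{\operatorname{Re}>\nu_0}=\{s\in\mathbb{C}: \operatorname{Re}s>\nu_0\}$. For $E,A\in L(H)$ put $\rho(E,A)=\{s\in\mathbb{C}: (sE+A)^{-1}\in L(H)\}$. The pair $(E,A)$ is called regular if there is $\nu_0\in\mathbb{R}$ with $\mathbb{C}_{\operatorname{Re}>\nu_0}\subseteq\rho(E,A)$ and there exist $C\geq 0$, $k\in\mathbb{N}$ such that $\|(sE+A)^{-1}\|\leq C|s|^{k}$ for all $s\in\mathbb{C}_{\operatorname{Re}>\nu_0}$. With such a $\nu_0$ fixed, the index is $$\operatorname{ind}(E,A)=\min\{k\in\mathbb{N}: \exists C\geq 0\ \forall s\in\mathbb{C}_{\operatorname{Re}>\nu_0}:\ \|(sE+A)^{-1}\|\leq C|s|^{k}\}.$$ The initial value spaces are defined by $\mathrm{IV}_0=H$ and $\mathrm{IV}_{j+1}=\{x\in H: Ax\in E[\mathrm{IV}_j]\}$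 for $j\in\mathbb{N}$, where $E[V]=\{Ev: v\in V\}$. The notation $u(0+)=u_0$ means that $\lim_{t\to 0+}u(t)=u_0$ in $H$. *)

(* Defs.v *)
From HB Require Import structures.
From mathcomp Require Import all_boot all_order all_algebra sesquilinear.
From mathcomp Require Import complex.
From mathcomp Require Import all_classical all_reals topology normedtype derive.

Set Implicit Arguments.
Unset Strict Implicit.
Unset Printing Implicit Defensive.

Import Order.TTheory GRing.Theory Num.Theory numFieldNormedType.Exports.
Local Open Scope classical_set_scope.
Local Open Scope ring_scope.
Local Open Scope complex_scope.

(* Restriction of scalars from R[i] to R. The additive group, the topology and
   the uniform structure are those of H, definitionally; only the scaling and
   the (R-valued) norm and balls are new. It gives access to the derivative of
   functions R -> H, which the library defines for normedModType R only. *)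
Definition realified (R : realType) (H : Type) : Type := H.

Section realified.
Context {R : realType}.

HB.instance Definition _ (H : normedModType R[i]) :=
  GRing.Zmodule.copy (realified R H) H.
HB.instance Definition _ (H : normedModType R[i]) :=
  PointedUniform.copy (realified R H) H.

Variable H : normedModType R[i].
Implicit Types (a b : R) (x y : realified R H).

Let scale a x : realified R H := a%:C *: (x : H).

Let scaleA a b x : scale a (scale b x) = scale (a * b) x.
Proof. by rewrite /scale scalerA -rmorphM. Qed.

Let scale1 : left_id 1 scale.
Proof. by move=> x; rewrite /scale rmorph1 scale1r. Qed.

Let scaleDr : right_distributive scale +%R.
Proof. by move=> a x y; rewrite /scale scalerDr. Qed.

Let scaleDl x : {morph scale^~ x : a b / a + b}.
Proof. by move=> a b; rewrite /scale rmorphD scalerDl. Qed.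

HB.instance Definition _ := GRing.Zmodule_isLmodule.Build R (realified R H)
  scaleA scale1 scaleDr scaleDl.

Let norm x : R := complex.Re `|x : H|.

Let normE x : `|x : H| = (norm x)%:C.
Proof. by rewrite RRe_real// ger0_real. Qed.

Let normD x y : norm (x + y) <= norm x + norm y.
Proof. by rewrite -lecR rmorphD /= -!normE ler_normD. Qed.

Let norm0_eq0 x : norm x = 0 -> x = 0.
Proof. by move=> x0; apply/normr0_eq0; rewrite normE x0. Qed.

Let normMn x n : norm (x *+ n) = norm x *+ n.
Proof. by apply: complexI; rewrite -normE rmorphMn /= -normE normrMn. Qed.

Let normN x : norm (- x) = norm x.
Proof. by rewrite /norm normrN. Qed.

HB.instance Definition _ := Num.Zmodule_isNormed.Build R (realified R H)
  normD norm0_eq0 normMn normN.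

Let rball x (e : R) y : Prop := `|x - y| < e.

Let rballE x e : rball x e = ball (x : H) e%:C.
Proof.
rewrite -ball_normE; apply/funext => y.
by rewrite /rball /ball_ /= normE ltcR.
Qed.

Let rball_center x (e : R) : 0 < e -> rball x e x.
Proof. by rewrite /rball subrr normr0. Qed.

Let rball_sym x y (e : R) : rball x e y -> rball y e x.
Proof. by rewrite /rball distrC. Qed.

Let rball_triangle x y z (e1 e2 : R) :
  rball x e1 y -> rball y e2 z -> rball x (e1 + e2) z.
Proof.
move=> xy yz; rewrite /rball -[x](subrK y) -addrA.
by rewrite (le_lt_trans (ler_normD _ _))// ltrD.
Qed.

Let rentourageE : entourage = entourage_ rball.
Proof.
transitivity (@entourage_ R[i] H H (@ball _ H)).
  by rewrite entourage_ballE.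
rewrite eqEsubset; split=> A [e /= e0 eA].
  have eE : e = (complex.Re e)%:C by rewrite RRe_real// gtr0_real.
  exists (complex.Re e) => /=; first by rewrite -ltcR -eE.
  by move=> xy; rewrite /= rballE -eE => /eA.
exists e%:C => /=; first by rewrite ltcR.
by move=> xy /=; rewrite -rballE => /eA.
Qed.

HB.instance Definition _ := Uniform_isPseudoMetric.Build R (realified R H)
  rball_center rball_sym rball_triangle rentourageE.

Let rballN : @ball _ (realified R H) = ball_ (fun x => `|x|).
Proof. by []. Qed.

HB.instance Definition _ :=
  NormedZmod_PseudoMetric_eq.Build R (realified R H) rballN.

Let normZ a x : `|a *: x| = `|a| * `|x|.
Proof.
apply: complexI; rewrite -[LHS]normE normrZ rmorphM /=.
by rewrite normc_def/= expr0n addr0 sqrtr_sqr -normE.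
Qed.

HB.instance Definition _ :=
  PseudoMetricNormedZmod_Lmodule_isNormedModule.Build R (realified R H) normZ.

End realified.

HB.instance Definition _ (R : realType) (H : completeNormedModType R[i]) :=
  Uniform_isComplete.Build (realified R H) (@cauchy_cvg H).

Section pencil.
Context {R : realType} {H : normedModType R[i]}.
Implicit Types (E A T : H -> H) (s : R[i]).

Definition rnorm (x : H) : R := `|(x : realified R H)|.

Lemma rnormE x : `|x| = (rnorm x)%:C.
Proof. by rewrite RRe_real// ger0_real. Qed.

Definition bounded_op T := exists M : R, forall x, rnorm (T x) <= M * rnorm x.

(* The supremum is junk unless T is bounded. *)
Definition opnorm T : R := sup [set rnorm (T x) | x in [set x | rnorm x <= 1]].

Definition pencil E A s : H -> H := fun x => s *: E x + A x.

(* pinv is only meaningful as an inverse when the pencil is bijective. *)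
Definition pencil_inv E A s : H -> H := pinv [set: H] (pencil E A s).

Definition resolvent_set E A : set R[i] :=
  [set s | [/\ bijective (pencil E A s), linear (pencil_inv E A s)
             & bounded_op (pencil_inv E A s)]].

Definition right_half_plane (nu0 : R) : set R[i] := [set s | nu0 < complex.Re s].

Definition resolvent_growth E A (nu0 : R) (k : nat) :=
  exists2 C : R, 0 <= C &
    forall s, right_half_plane nu0 s ->
      opnorm (pencil_inv E A s) <= C * `|(s : Rcomplex R)| ^+ k.

(* A pair (E, A) is regular when it is regular_at some nu0. *)
Definition regular_at E A (nu0 : R) :=
  right_half_plane nu0 `<=` resolvent_set E A /\
  exists k, resolvent_growth E A nu0 k.

Definition ind E A (nu0 : R) : nat :=
  xget 0%N [set k | resolvent_growth E A nu0 k /\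
                    forall j, resolvent_growth E A nu0 j -> (k <= j)%N].

Lemma indP E A (nu0 : R) : regular_at E A nu0 ->
  resolvent_growth E A nu0 (ind E A nu0) /\
  forall j, resolvent_growth E A nu0 j -> (ind E A nu0 <= j)%N.
Proof.
move=> [_ [k kP]]; rewrite /ind; case: xgetP => [j _ //|no].
have ex : exists k, `[< resolvent_growth E A nu0 k >] by exists k; apply/asboolP.
case: (ex_minnP ex) => m /asboolP mP mmin; case: (no m); split=> // j jP.
exact/mmin/asboolP.
Qed.

Fixpoint IV E A (j : nat) : set H :=
  if j is j'.+1 then [set x | (E @` IV E A j') (A x)] else [set: H].

(* Only the values of u on ]0, +oo[ matter. *)
Definition is_solution E A (u0 : H) (u : R -> realified R H) :=
  [/\ forall t : R, 0 < t -> derivable u t 1 /\ {for t, continuous (derive1 u)},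
      u t @[t --> 0^'+] --> (u0 : realified R H)
    & forall t : R, 0 < t -> E (derive1 u t) + A (u t) = 0].

End pencil.

(* Main.v *)
Require Import Defs.
From HB Require Import structures.
From mathcomp Require Import all_boot all_order all_algebra sesquilinear.
From mathcomp Require Import complex.
From mathcomp Require Import all_classical all_reals topology normedtype derive.
From mathcomp Require Import sequences exp ring lra.

Set Implicit Arguments.
Unset Strict Implicit.
Unset Printing Implicit Defensive.

Import Order.TTheory GRing.Theory Num.Theory numFieldNormedType.Exports.
Local Open Scope classical_set_scope.
Local Open Scope ring_scope.
Local Open Scope complex_scope.

(** Write [k] for the index, [V j] for the initial value spaces, [Y] for the
closed space [E (V k)] and [S s] for the inverse of [s E + A]. The point is
that on [V k.+1], which is the preimage of [Y] under [A] and hence closed, the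
equation is an ordinary linear differential equation with a bounded generator.

Since [s S(s) E x = x - S(s) A x] and [A x = E y] with [y] in [V j] when [x] is
in [V j.+1], each passage from [V j] to [V j.+1] gains one power of [s]: from
[|S(s)| = O(s^k)] it follows that [S(s) A x] is bounded for [x] in [V k]
([resolvent_growth_consistent]). So [s S(s)] is pointwise bounded on [Y], and
uniformly bounded there because [Y] is complete
([scaled_resolvent_bounded]). For [x] in [V k.+1] one gets
[s S(s) E x -> x], so [E] is injective on [V k.+1] ([E_inj_consistent]); as
[E (s S(s) y) -> y] for [y] in [Y], these [y] are limits of elements of
[E (V k.+1)], whence [s S(s) y] converges for every [y] in [Y], to a preimage
of [y] in [V k.+1] ([E_solvable]). Thus [E : V k.+1 -> Y] is bijective with
bounded inverse, and [B = - E^-1 A] is a bounded operator on [V k.+1]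
([flow_generator]).

Existence: [u t = exp (t B) u0], written as the series of the
[t^n / n! B^n u0]. It is differentiated by comparing its first order Taylor
remainder with that of the scalar function [exp] ([exp_sum_taylor1]), which
avoids any integration of vector-valued functions.

Uniqueness: let [w] be a solution with [w(0+) = 0]. If [w] takes its values in
[V k.+1] then so does [w'], whence [w' = B w], and [exp (- 2 b t) |w t|^2] is
nonincreasing with limit [0] at [0+] for [b] a bound of [B]
([gronwall_zero]); this is where the inner product enters.
In general [S(s) E w] is again a null solution, with values one step further in
the chain of the [V j], and [w] vanishes as soon as [S(s) E w] does
([null_solution_eq0]).

With real [s], everything but the last part takes place in a real Banach space,
which is then specialized to the realification of [H]. *)

(** * Uniform boundedness on a closed subspace *)

Lemma norm_bounded_continuous (R : realType) (V W : normedModType R)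
    (f : {linear V -> W}) (M : R) :
  (forall x, `|f x| <= M * `|x|) -> continuous f.
Proof.
move=> fM; apply/bounded_linear_continuous/bounded_funP => r.
exists (`|M| * `|r|) => x xr.
apply: le_trans (fM x) _.
apply: le_trans (ler_wpM2r _ (ler_norm M)) _ => //.
by rewrite ler_wpM2l// (le_trans xr)// ler_norm.
Qed.

Lemma cvg_norm_le (R : realType) (V : normedModType R) (T : Type)
    (F : set_system T) (FF : ProperFilter F) (f : T -> V) (l : V) (M : R) :
  f @ F --> l -> (\forall t \near F, `|f t| <= M) -> `|l| <= M.
Proof.
move=> /cvg_norm fl fM; rewrite -(cvg_lim _ fl)//.
by apply: limr_le => //; apply/cvg_ex; exists `|l|.
Qed.

Definition is_subspace (R : realType) (V : lmodType R) (Y : set V) :=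
  Y 0 /\ forall a x y, Y x -> Y y -> Y (a *: x + y).

Lemma subspaceB (R : realType) (V : lmodType R) (Y : set V) x y :
  is_subspace Y -> Y x -> Y y -> Y (x - y).
Proof. by move=> [_ YD] Yx Yy; rewrite addrC -scaleN1r; exact: YD. Qed.

Lemma subspaceZ (R : realType) (V : lmodType R) (Y : set V) a x :
  is_subspace Y -> Y x -> Y (a *: x).
Proof. by move=> [Y0 YD] Yx; rewrite -[_ *: _]addr0; exact: YD. Qed.

Lemma nested_balls_cvg (R : realType) (V : completeNormedModType R)
    (x : nat -> V) (r : nat -> R) :
  (forall n, 0 < r n) -> (forall n, r n.+1 <= r n / 2) ->
  (forall n, `|x n.+1 - x n| <= r n / 2) ->
  exists2 l : V, x @ \oo --> l & forall n, `|l - x n| <= r n.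
Proof.
move=> r0 rS xS.
have xd n m : `|x (m + n)%N - x n| <= r n - r (m + n)%N.
  elim: m => [|m IH]; first by rewrite add0n !subrr normr0.
  rewrite addSn -[x _.+1](subrK (x (m + n)%N)) -addrA.
  rewrite (le_trans (ler_normD _ _))//.
  by have := xS (m + n)%N; have := rS (m + n)%N; move: IH; lra.
have xr n m : (n <= m)%N -> `|x m - x n| <= r n.
  by move=> nm; have := xd n (m - n)%N; have := r0 m; rewrite subnK//; lra.
have rexp n : r n <= r 0%N * 2^-1 ^+ n.
  elim: n => [|n IH]; first by rewrite expr0 mulr1.
  by rewrite exprSr mulrA; move: (rS n) IH; lra.
have rcvg : r @ \oo --> 0.
  apply: (@squeeze_cvgr _ _ _ _ (fun=> 0) (fun n => r 0%N * 2^-1 ^+ n)).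
  - by apply: nearW => n; rewrite (ltW (r0 n)) rexp.
  - exact: cvg_cst.
  - rewrite -[X in _ --> X](mulr0 (r 0%N)).
    apply: cvgM; first exact: cvg_cst.
    by apply: cvg_expr; rewrite ger0_norm; lra.
have cx : cvg (x @ \oo).
  apply: cauchy_cvg; apply: cauchy_exP => e e0.
  have /cvgrPdist_lt/(_ _ e0)[n _ /(_ n (leqnn n))] := rcvg.
  rewrite /= sub0r normrN gtr0_norm// => rne.
  exists (x n); exists n => // m nm; rewrite -ball_normE /ball_/= distrC.
  exact: le_lt_trans (xr _ _ nm) rne.
exists (lim (x @ \oo)) => // n.
apply: (@cvg_norm_le _ _ _ \oo _ (fun m => x m - x n)).
  by apply: cvgB => //; exact: cvg_cst.
by exists n => // m; exact: xr.
Qed.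

(** Banach-Steinhaus for operators restricted to a closed subspace [Y]. As [Y]
is a set and not a normed space of its own, the gliding hump is run in the
ambient space, with all centres in [Y]. *)
Section uniform_boundedness.
Context {R : realType} {V : completeNormedModType R} {W : normedModType R}.
Variables (Y : set V) (T : nat -> {linear V -> W}).
Hypothesis Ysub : is_subspace Y.
Hypothesis Tcont : forall n, continuous (T n).

(** If [|T d|] is large then so is one of [|T (x + d)|], [|T (x - d)|], since
their sum is at least [2 |T d|]: an unbounded family is already unbounded on
every ball. *)
Lemma large_value_near (x : V) (r N : R) : 0 < r -> 0 <= N -> Y x ->
  (forall M, exists n, exists2 y, Y y & M * `|y| < `|T n y|) ->
  exists n, exists2 z, Y z & `|z - x| <= r / 2 /\ N < `|T n z|.
Proof.
move=> r0 N0 Yx /(_ (2 * N / r))[n [y Yy ny]].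
have y0 : 0 < `|y|.
  rewrite normr_gt0; apply: contraTneq ny => ->.
  by rewrite linear0 !normr0 mulr0 ltxx.
pose d := (r / 2 / `|y|) *: y.
have c0 : 0 < r / 2 / `|y| by rewrite !divr_gt0.
have dr : `|d| = r / 2 by rewrite normrZ gtr0_norm// divfK// gt_eqF.
have Yd : Y d by exact: subspaceZ.
have Td : N < `|T n d|.
  rewrite /d linearZ/= normrZ gtr0_norm//.
  move: ny; rewrite -(ltr_pM2l c0); apply: le_lt_trans.
  rewrite le_eqVlt; apply/orP; left; apply/eqP.
  by field; rewrite !gt_eqF.
have [lt1|ge1] := ltP N `|T n (x - d)|.
  exists n, (x - d); first exact: subspaceB.
  by rewrite addrAC subrr add0r normrN dr lexx.
exists n, (x + d).
  by rewrite -[d]opprK; apply: subspaceB => //; rewrite -scaleN1r; exact: subspaceZ.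
rewrite addrAC subrr add0r dr lexx; split => //.
have : `|T n (x + d) - T n (x - d)| = 2 * `|T n d|.
  by rewrite -linearB/= opprB addrCA [x + d]addrC addrK -mulr2n linearMn normrMn mulr_natl.
have := ler_normB (T n (x + d)) (T n (x - d)).
move: ge1 Td; lra.
Qed.

Theorem uniform_boundedness : closed Y ->
  (forall y, Y y -> exists M, forall n, `|T n y| <= M) ->
  exists M, forall n y, Y y -> `|T n y| <= M * `|y|.
Proof.
move=> Ycl ptb; apply: contrapT => nob.
have {}nob M : exists n, exists2 y, Y y & M * `|y| < `|T n y|.
  apply: contrapT => h; apply: nob; exists M => n y Yy; rewrite leNgt.
  by apply/negP => lt; apply: h; exists n, y.
pose good (p : V * R) := Y p.1 /\ 0 < p.2.
(* A state [(x, r)] is a closed ball; the next ball lies inside it and some [T n]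
   has norm at least [N] on all of it. *)
have step (Np : nat * (V * R)) : exists q : V * R, good Np.2 ->
    [/\ good q, q.2 <= Np.2.2 / 2, `|q.1 - Np.2.1| <= Np.2.2 / 2 &
     exists n, forall z, `|z - q.1| <= q.2 -> Np.1%:R <= `|T n z|].
  case: Np => N [x r] /=.
  have [[Yx r0]|ng] := pselect (good (x, r)); last by exists (x, r).
  have [n [z Yz [zx Nz]]] := large_value_near r0 (ler0n _ N) Yx nob.
  have : \forall w \near z, N%:R < `|T n w|.
    have : (fun w => `|T n w|) @ z --> `|T n z|.
      by apply: cvg_norm; exact: Tcont.
    by move=> /cvgr_gt; apply.
  move=> /nbhs_ballP[e /= e0 ez].
  exists (z, Num.min (e / 2) (r / 2)) => _; split => //=.
  - by split => //=; rewrite lt_min !divr_gt0.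
  - by rewrite ge_min lexx orbT.
  - exists n => w; rewrite le_min => /andP[we _]; apply/ltW/ez.
    by rewrite -ball_normE /ball_/= distrC (le_lt_trans we)//; lra.
have [f fP] := choice step.
pose st := fix st n := if n is m.+1 then f (m, st m) else (0, 1).
have stg n : good (st n).
  elim: n => [|n IH]; first by split => //=; case: Ysub.
  by have [] := fP (n, st n) IH.
have [l xl ln] : exists2 l : V, (fun n => (st n).1) @ \oo --> l &
    forall n, `|l - (st n).1| <= (st n).2.
  apply: nested_balls_cvg => n; first by case: (stg n).
    by have [] := fP (n, st n) (stg n).
  by have [] := fP (n, st n) (stg n).
have Yl : Y l.
  by apply: (closed_cvg Y Ycl _ _ xl); apply: nearW => n; case: (stg n).
have [M TM] := ptb l Yl.
pose N := (Num.truncn M).+1.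
have [_ _ _ [n /(_ l (ln N.+1)) TN]] := fP (N, st N) (stg N).
have := le_trans TN (TM n); rewrite leNgt => /negP; apply.
exact: truncnS_gt.
Qed.

End uniform_boundedness.

(** A uniformly bounded sequence of operators that converges on the points of a
sequence tending to [y] converges at [y], by a three-epsilon argument. *)
Lemma cvg_from_dense (R : realType) (V : completeNormedModType R)
    (W : completeNormedModType R) (Y : set V) (T : nat -> {linear V -> W})
    (M : R) (y : V) (z : nat -> V) :
  is_subspace Y -> (forall n v, Y v -> `|T n v| <= M * `|v|) ->
  (forall m, Y (z m)) -> z @ \oo --> y -> Y y ->
  (forall m, cvg (T n (z m) @[n --> \oo])) -> cvg (T n y @[n --> \oo]).
Proof.
move=> Ysub TM Yz zy Yy Tz; apply: cauchy_cvg; apply: cauchy_exP => e e0.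
have M0 : 0 < `|M| + 1 by rewrite ltr_wpDl.
have /cvgrPdist_lt/(_ (e / 2 / (`|M| + 1)))[|m _ /(_ m (leqnn m))/= ym] := zy.
  by rewrite !divr_gt0.
exists (lim (T n (z m) @[n --> \oo])).
have /cvgrPdist_lt/(_ (e / 2))[|n0 _ nP] := Tz m; first by rewrite divr_gt0.
exists n0 => // n /nP; rewrite -ball_normE /ball_/= => h.
rewrite -[X in X - _](subrK (T n (z m))) -addrA.
rewrite (le_lt_trans (ler_normD _ _))// [e]splitr ltrD// distrC -linearB/=.
rewrite (le_lt_trans (TM n _ (subspaceB Ysub Yy (Yz m))))//.
apply: le_lt_trans (_ : (`|M| + 1) * `|y - z m| < _).
  by rewrite ler_wpM2r// (le_trans (ler_norm M))// lerDl.
by rewrite mulrC -ltr_pdivlMr.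
Qed.

(** * The exponential series in a Banach space *)

Lemma is_derive1P (R : numFieldType) (V : normedModType R) (f : R -> V)
    (t : R) (l : V) :
  is_derive t 1 f l <-> h^-1 *: (f (h + t) - f t) @[h --> 0^'] --> l.
Proof.
have E : (fun h => h^-1 *: ((f \o shift t) (h *: 1) - f t)) =
         (fun h => h^-1 *: (f (h + t) - f t)).
  by apply/funext => h; rewrite /= [h *: 1]mulr1.
split=> [[df <-]|fl]; first by move: df; rewrite /derive /derivable E.
have df : derivable f t 1 by rewrite /derivable E; apply/cvg_ex; exists l.
by apply: DeriveDef => //; rewrite /derive E; exact: cvg_lim fl.
Qed.

Lemma is_derive_linear (R : realType) (V W : normedModType R)
    (f : R -> V) (t : R) (l : V) (T : {linear V -> W}) :
  continuous T -> is_derive t 1 f l -> is_derive t 1 (T \o f) (T l).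
Proof.
move=> Tc /is_derive1P fl; apply/is_derive1P => /=.
under eq_fun do rewrite -linearB -linearZ/=.
by apply: continuous_cvg => //; exact: Tc.
Qed.

Section exponential_series.
Context {R : realType} {X : completeNormedModType R}.
Implicit Types (x : nat -> X) (t h b c : R).

(** With [x n = B^n x0] this is [exp (t B) x0]; only the orbit [x] enters, so
that [B] may live on a subspace and its values may be picked one at a time. *)
Definition exp_term x t n : X := (t ^+ n / n`!%:R) *: x n.
Definition exp_sum x t : X := lim (series (exp_term x t) @ \oo).

Lemma normr_exp_term x t b c : (forall n, `|x n| <= c * b ^+ n) ->
  forall n, `|exp_term x t n| <= c * exp_coeff (b * `|t|) n.
Proof.
move=> xb n; rewrite /exp_term /exp_coeff/= normrZ normrM normfV normrX.
have -> : c * ((b * `|t|) ^+ n / n`!%:R) = `|t| ^+ n / n`!%:R * (c * b ^+ n).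
  by rewrite exprMn; ring.
rewrite normr_nat ler_wpM2l//.
by rewrite divr_ge0 ?exprn_ge0.
Qed.

Lemma exp_sum_cvg x t b c : (forall n, `|x n| <= c * b ^+ n) ->
  series (exp_term x t) @ \oo --> exp_sum x t.
Proof.
move=> xb; apply: normed_cvg.
apply: (@series_le_cvg _ _ (fun n => c * exp_coeff (b * `|t|) n)) => [n|n|n|].
- exact: normr_ge0.
- exact: le_trans (normr_exp_term t xb n).
- exact: normr_exp_term.
- by apply: is_cvg_seriesZ; exact: is_cvg_series_exp_coeff.
Qed.

Lemma exp_sum0 x b c : (forall n, `|x n| <= c * b ^+ n) -> exp_sum x 0 = x 0%N.
Proof.
move=> xb; apply: cvg_unique (exp_sum_cvg (t := 0) xb) _ => //=.
rewrite -(@cvg_shiftS _ (series (exp_term x 0))); apply: cvg_near_cst; apply: nearW => n.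
rewrite /series /= big_mkord big_ord_recl big1 => [|i _].
  by rewrite /exp_term expr0 fact0 divr1 scale1r addr0.
by rewrite /exp_term expr0n mul0r scale0r.
Qed.

(** Expanding the left-hand power leaves only monomials with nonnegative
coefficients, so passing to absolute values can only increase it. The induction
uses the recursion [E] of the remainders. *)
Lemma taylor1_norm_le t h n :
  `|(t + h) ^+ n.+1 - t ^+ n.+1 - n.+1%:R * h * t ^+ n| <=
  (`|t| + `|h|) ^+ n.+1 - `|t| ^+ n.+1 - n.+1%:R * `|h| * `|t| ^+ n.
Proof.
have E (a d : R) m : (a + d) ^+ m.+2 - a ^+ m.+2 - m.+2%:R * d * a ^+ m.+1 =
    (a + d) * ((a + d) ^+ m.+1 - a ^+ m.+1 - m.+1%:R * d * a ^+ m) +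
    m.+1%:R * d ^+ 2 * a ^+ m.
  by rewrite -[m.+2%:R]natr1 !exprS; ring.
elim: n => [|n IH].
  rewrite [X in `|X|](_ : _ = 0); last by ring.
  by rewrite normr0 le_eqVlt; apply/orP; left; apply/eqP; ring.
rewrite !E (le_trans (ler_normD _ _))// lerD//.
  by rewrite normrM ler_pM// ler_normD.
by rewrite !normrM !normrX ger0_norm.
Qed.

(** Dividing the previous lemma by [n!] and summing bounds the Taylor remainder of
the vector series by the one of the scalar function [exp]. *)
Lemma exp_sum_taylor1 x t h b c : 0 <= b -> (forall n, `|x n| <= c * b ^+ n) ->
  `|exp_sum x (h + t) - exp_sum x t - h *: exp_sum (fun n => x n.+1) t| <=
  c * (expR (b * (`|h| + `|t|)) - expR (b * `|t|) - b * `|h| * expR (b * `|t|)).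
Proof.
move=> b0 xb.
have xSb n : `|x n.+1| <= (c * b) * b ^+ n by rewrite -mulrA -exprS.
have cS (y : nat -> X) (z : X) :
    series y @ \oo --> z -> series y n.+1 @[n --> \oo] --> z.
  by rewrite cvg_shiftS.
have cR y : series (exp_coeff y) @ \oo --> (expR y : R).
  exact: is_cvg_series_exp_coeff.
have cRS y : series (exp_coeff y) n.+1 @[n --> \oo] --> (expR y : R).
  by rewrite cvg_shiftS; exact: cR.
have lhs : (fun n => `|series (exp_term x (h + t)) n.+1 -
      series (exp_term x t) n.+1 -
      h *: series (exp_term (fun n => x n.+1) t) n|) @ \oo -->
    `|exp_sum x (h + t) - exp_sum x t - h *: exp_sum (fun n => x n.+1) t|.
  apply: cvg_norm; apply: cvgB.
    by apply: cvgB; apply: cS; exact: exp_sum_cvg xb.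
  by apply: cvgZ; [exact: cvg_cst|exact: exp_sum_cvg xSb].
have rhs : (fun n => c * (series (exp_coeff (b * (`|h| + `|t|))) n.+1 -
      series (exp_coeff (b * `|t|)) n.+1 -
      b * `|h| * series (exp_coeff (b * `|t|)) n)) @ \oo -->
    c * (expR (b * (`|h| + `|t|)) - expR (b * `|t|) - b * `|h| * expR (b * `|t|)).
  apply: cvgM; first exact: cvg_cst.
  apply: cvgB; first by apply: cvgB; exact: cRS.
  by apply: cvgM; [exact: cvg_cst|exact: cR].
apply: (ler_cvg_to lhs rhs); apply: nearW => n.
have shift0 (V : zmodType) (v p q : V) : v + p - (v + q) = p - q.
  by rewrite opprD addrACA subrr add0r.
(* The sums for [exp_sum x] have one more term than the one for the shifted
   sequence; their terms of index [0] cancel. *)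
rewrite /series /= !big_mkord !big_ord_recl.
have T0 r : exp_term x r (ord0 : 'I_n.+1) = x 0%N.
  by rewrite /exp_term expr0 fact0 divr1 scale1r.
have C0 r : exp_coeff r (ord0 : 'I_n.+1) = 1 by rewrite /exp_coeff/= expr0 fact0 divr1.
rewrite !T0 !C0 !shift0 scaler_sumr mulr_sumr -!sumrB mulr_sumr (le_trans (ler_norm_sum _ _ _))//.
apply: ler_sum => i _; rewrite /exp_term /exp_coeff /= /bump /= add1n factS.
have f0 : (i`!%:R : R) != 0 by rewrite pnatr_eq0 -lt0n fact_gt0.
have i0 : (i.+1%:R : R) != 0 by rewrite pnatr_eq0.
rewrite scalerA -!(scalerBl _ _ (x i.+1)) natrM.
have split_coeff (p f u v q w : R) : p != 0 -> f != 0 ->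
    u / (p * f) - v / (p * f) - q * (w / f) = (p * f)^-1 * (u - v - p * q * w).
  by move=> p0 f0'; field; rewrite p0 f0'.
rewrite !split_coeff// [h + t]addrC.
rewrite normrZ normrM ger0_norm ?invr_ge0 ?mulr_ge0//.
apply: le_trans (ler_wpM2r (normr_ge0 _) (ler_wpM2l _ (taylor1_norm_le t h i))) _.
  by rewrite invr_ge0 mulr_ge0.
apply: le_trans (ler_wpM2l _ (xb i.+1)) _.
  rewrite mulr_ge0 ?invr_ge0 ?mulr_ge0//.
  exact: le_trans (normr_ge0 _) (taylor1_norm_le t h i).
rewrite [`|h| + _]addrC !exprMn !exprS le_eqVlt; apply/orP; left; apply/eqP.
by ring.
Qed.

Lemma is_derive_exp_sum x t b c : 0 <= b -> (forall n, `|x n| <= c * b ^+ n) ->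
  is_derive t 1 (exp_sum x) (exp_sum (fun n => x n.+1) t).
Proof.
move=> b0 xb; apply/is_derive1P.
have dE : h^-1 * (expR (b * (h + `|t|)) - expR (b * `|t|)) @[h --> 0^'] -->
    b * expR (b * `|t|).
  apply/(@is_derive1P _ _ (fun r => expR (b * r))).
  by apply: is_derive_eq; rewrite /GRing.scale /=; ring.
have c0 : 0 <= c by have := xb 0%N; rewrite expr0 mulr1; exact: le_trans.
apply/cvgrPdist_le => e e0.
have /cvgrPdist_lt/(_ (e / (c + 1)))[|d /= d0 dP] := dE.
  by rewrite divr_gt0// ltr_wpDl.
exists d => //= h; rewrite /ball_/= sub0r normrN => hd h0.
have {dP} := dP `|h|; rewrite /ball_/= sub0r normrN normr_id normr_eq0 => /(_ hd h0).
have h'0 : 0 < `|h| by rewrite normr_gt0.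
rewrite distrC => /ltW /(le_trans (ler_norm _)) dP.
rewrite distrC -(ler_pM2l h'0) -normrZ scalerBr scalerA divff// scale1r.
apply: le_trans (exp_sum_taylor1 t h b0 xb) _.
apply: le_trans (_ : c * (`|h| * (e / (c + 1))) <= _).
  rewrite ler_wpM2l//; have := ler_wpM2l (ltW h'0) dP.
  by rewrite /GRing.scale/= mulrBr mulVKf ?gt_eqF// [`|h| * (b * _)]mulrA [`|h| * b]mulrC.
rewrite mulrCA ler_wpM2l// mulrA ler_pdivrMr ?ltr_wpDl//.
by rewrite mulrC ler_wpM2l ?lerDl// ltW.
Qed.

End exponential_series.

(** * A Gronwall argument for the squared norm *)

Lemma near0_add_gt0 (R : realType) (t : R) : 0 < t ->
  \forall h \near (0 : R)^', 0 < h + t.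
Proof.
move=> t0; exists t => //= h; rewrite /ball_/= sub0r normrN ltr_norml.
by move=> /andP[th _] _; rewrite -ltrBlDr sub0r.
Qed.

(** The behaviour of an inner product norm along a line, phrased with norms alone: [|x + y|^2 - |x|^2 - |y|^2] stands for [2 Re <x, y>]. *)
Definition quadratic_norm (R : realType) (X : normedModType R) :=
  forall (x y : X) (r : R), `|x + r *: y| ^+ 2 =
    `|x| ^+ 2 + r * (`|x + y| ^+ 2 - `|x| ^+ 2 - `|y| ^+ 2) + r ^+ 2 * `|y| ^+ 2.

Section gronwall.
Context {R : realType} {X : normedModType R}.
Hypothesis norm2_line : quadratic_norm X.

(** [quadratic_norm] turns the difference quotient of [|w|^2] into a continuous
function of the difference quotient [q] of [w], up to a term [h |q|^2]. *)
Lemma is_derive_norm2 (w : R -> X) (t : R) (w' : X) : is_derive t 1 w w' ->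
  is_derive t 1 (fun r => `|w r| ^+ 2)
    (`|w t + w'| ^+ 2 - `|w t| ^+ 2 - `|w'| ^+ 2).
Proof.
move=> /is_derive1P ww'; apply/is_derive1P.
pose q h := h^-1 *: (w (h + t) - w t).
apply: (@cvg_trans _ (((`|w t + q h| ^+ 2 - `|w t| ^+ 2 - `|q h| ^+ 2) +
    h * `|q h| ^+ 2) @[h --> (0:R)^'])).
  apply: near_eq_cvg; near=> h.
  have h0 : h != 0 by near: h; exact: nbhs_dnbhs_neq.
  have -> : w (h + t) = w t + h *: q h.
    by rewrite /q scalerA divff// scale1r [RHS]addrC subrK.
  by rewrite (norm2_line (w t) (q h) h) /GRing.scale/=; field.
have q2 : `|q h| ^+ 2 @[h --> (0:R)^'] --> `|w'| ^+ 2.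
  by under eq_fun do rewrite expr2; rewrite expr2; apply: cvgM; exact: cvg_norm.
rewrite -[_ - `|w'| ^+ 2]addr0; apply: cvgD.
  apply: cvgB => //; apply: cvgB; last exact: cvg_cst.
  have wq : `|w t + q h| @[h --> (0:R)^'] --> `|w t + w'|.
    by apply: cvg_norm; apply: cvgD => //; exact: cvg_cst.
  by under eq_fun do rewrite expr2; rewrite expr2; exact: cvgM.
suff : h * `|q h| ^+ 2 @[h --> (0:R)^'] --> 0 * `|w'| ^+ 2 by rewrite mul0r.
by apply: cvgM => //; exact: cvg_within.
Unshelve. all: by end_near. Qed.

(** [f r = exp (- 2 b r) |w r|^2] is nonincreasing, since the derivative of
[|w|^2] is at most [2 |w| |w'|], and it tends to [0] at [0+]. *)
Lemma gronwall_zero (b : R) (w w' : R -> X) :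
  (forall t : R, 0 < t -> is_derive t 1 w (w' t)) ->
  (forall t : R, 0 < t -> `|w' t| <= b * `|w t|) ->
  w t @[t --> (0:R)^'+] --> 0 -> forall t : R, 0 < t -> w t = 0.
Proof.
move=> dw w'b w0 t t0.
pose f (r : R) : R := expR (- (2 * b) * r) * `|w r| ^+ 2.
pose g (r : R) : R := expR (- (2 * b) * r) *
  ((`|w r + w' r| ^+ 2 - `|w r| ^+ 2 - `|w' r| ^+ 2) - 2 * b * `|w r| ^+ 2).
have df (r : R) : 0 < r -> is_derive r 1 f (g r).
  move=> r0; have dn := is_derive_norm2 (dw r r0).
  apply: is_derive_eq; rewrite /g /GRing.scale/= /GRing.scale/=; ring.
have g0 (r : R) : 0 < r -> g r <= 0.
  move=> r0; rewrite /g pmulr_rle0 ?expR_gt0// subr_le0.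
  have nD := ler_normD (w r) (w' r); have wb := w'b r r0.
  have n0 := normr_ge0 (w r); have n1 := normr_ge0 (w r + w' r).
  by nra.
have fle (d : R) : 0 < d -> d <= t -> f t <= f d.
  move=> d0 dt; apply: (@ler0_derive1_nincry _ f d) => //.
  - move=> x; rewrite in_itv/= andbT => dx.
    by have [] := df x (lt_trans d0 dx).
  - move=> x; rewrite in_itv/= andbT => dx; rewrite derive1E.
    by have [_ ->] := df x (lt_trans d0 dx); apply/g0/(lt_trans d0).
  - apply: derivable_within_continuous => x; rewrite in_itv/= andbT => dx.
    by have [] := df x (lt_le_trans d0 dx).
have f0 : f d @[d --> (0:R)^'+] --> (0 : R).
  suff : f d @[d --> (0:R)^'+] --> expR (- (2 * b) * 0) * 0 by rewrite mulr0.
  apply: cvgM.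
    apply: cvg_at_right_filter; apply: continuous_cvg; first exact: continuous_expR.
    by apply: cvgM; [exact: cvg_cst|exact: cvg_id].
  have w0' : `|w d| @[d --> (0:R)^'+] --> (0 : R).
    by have h := cvg_norm w0; rewrite normr0 in h; exact: h.
  have h := cvgM w0' w0'; rewrite mulr0 in h; exact: h.
have ft0 : f t <= 0.
  apply: (ler_cvg_to (cvg_cst (f t)) f0); near=> d; apply: fle.
    by near: d; exact: nbhs_right_gt.
  by near: d; exact: nbhs_right_le.
apply/eqP; rewrite -normr_eq0 -sqrf_eq0 eq_le sqr_ge0 andbT.
by move: ft0; rewrite /f pmulr_rle0 ?expR_gt0.
Unshelve. all: by end_near. Qed.

End gronwall.

(** * Initial value spaces and the resolvent of a pencil *)

(** The initial value spaces, for maps of an arbitrary type: over a real Banach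
space they are needed before any complex structure is present. *)
Fixpoint consistent (T : Type) (E A : T -> T) (j : nat) : set T :=
  if j is j'.+1 then [set x | (E @` consistent E A j') (A x)] else setT.

Section consistent_theory.
Context {R : realType} {X : completeNormedModType R}.
Variables (E A : {linear X -> X}).
Local Notation V := (consistent E A).

Lemma consistent_subspace j : is_subspace (V j).
Proof.
elim: j => [//|j [V0 VD]]; split.
  by exists 0 => //; rewrite !linear0.
move=> a x y /= [x' Vx' Ex'] [y' Vy' Ey']; exists (a *: x' + y'); first exact: VD.
by rewrite !linearP Ex' Ey'.
Qed.

Lemma consistent_decr j : V j.+1 `<=` V j.
Proof.
elim: j => [//|j IH] x [y Vy Ey]; exists y => //; exact: IH.
Qed.

Lemma image_consistent_subspace j : is_subspace (E @` V j).
Proof.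
have [V0 VD] := consistent_subspace j; split; first by exists 0; rewrite ?linear0.
move=> a _ _ [x Vx <-] [y Vy <-]; exists (a *: x + y); first exact: VD.
by rewrite linearP.
Qed.

Section resolvent.
Variables (s : R) (S : {linear X -> X}).
Hypothesis SK : forall x, S (s *: E x + A x) = x.
Hypothesis KS : forall y, s *: E (S y) + A (S y) = y.

(** The identity that trades a factor [s] for one step in the chain of initial
value spaces. *)
Lemma scale_resolventE x : s *: S (E x) = x - S (A x).
Proof. by apply/(canRL (addrK _)); rewrite -linearZ -linearD SK. Qed.

Lemma A_resolventE x : A (S (E x)) = E (x - s *: S (E x)).
Proof. by rewrite linearB linearZ/=; apply/(canRL (addrK _)); rewrite addrC KS. Qed.

(** Both sides equal [E x - s E S E x]; this makes [S \o E] map solutions to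
solutions. *)
Lemma A_resolvent_comm x : A (S (E x)) = E (S (A x)).
Proof. by rewrite A_resolventE scale_resolventE opprB addrCA subrr addr0. Qed.

Lemma resolventE_consistent j x : V j x -> V j.+1 (S (E x)).
Proof.
elim: j x => [|j IH] x Vx; exists (x - s *: S (E x)); rewrite ?A_resolventE//.
have Vs := consistent_subspace j.+1.
by apply: subspaceB => //; apply: subspaceZ => //; exact/IH/consistent_decr.
Qed.

End resolvent.

End consistent_theory.

(** * Solutions of the differential equation *)

Section cauchy_problem.
Context {R : realType} {X : completeNormedModType R}.
Variables (E A : {linear X -> X}).
Hypothesis A_cont : continuous A.
Hypothesis E_cont : continuous E.

Section existence.
Variables (x : nat -> X) (b c : R).
Hypothesis b_ge0 : 0 <= b.
Hypothesis x_le : forall n, `|x n| <= c * b ^+ n.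
Hypothesis x_rec : forall n, E (x n.+1) = - A (x n).

Let xS_le n : `|x n.+1| <= (c * b) * b ^+ n.
Proof. by rewrite -mulrA -exprS. Qed.

Lemma exp_sum_solves t :
  E (exp_sum (fun n => x n.+1) t) + A (exp_sum x t) = 0.
Proof.
have ES : E (series (exp_term (fun n => x n.+1) t) n) @[n --> \oo] -->
    E (exp_sum (fun n => x n.+1) t).
  by apply: continuous_cvg; [exact: E_cont|exact: exp_sum_cvg xS_le].
have AS : A (series (exp_term x t) n) @[n --> \oo] --> A (exp_sum x t).
  by apply: continuous_cvg; [exact: A_cont|exact: exp_sum_cvg x_le].
apply: cvg_unique (cvgD ES AS) _ => //=.
apply: cvg_near_cst; apply: nearW => n.
rewrite fctE /series !linear_sum -big_split big1// => i _.
by rewrite /exp_term !linearZ/= x_rec scalerN addNr.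
Qed.

Lemma exp_sum_cvg_at_right0 : exp_sum x t @[t --> (0:R)^'+] --> x 0%N.
Proof.
rewrite -(exp_sum0 x_le); apply: cvg_at_right_filter.
have [d _] := is_derive_exp_sum 0 b_ge0 x_le.
by apply: differentiable_continuous; apply/derivable1_diffP.
Qed.

End existence.

Section uniqueness.
Variables (s : R) (S : {linear X -> X}) (k : nat) (b : R).
Hypothesis norm2_line : quadratic_norm X.
Hypothesis S_cont : continuous S.
Hypothesis SK : forall x, S (s *: E x + A x) = x.
Hypothesis KS : forall y, s *: E (S y) + A (S y) = y.
Hypothesis Vk_closed : closed (consistent E A k).
Hypothesis flow_bounded : forall x y, consistent E A k x ->
  consistent E A k y -> E y + A x = 0 -> `|y| <= b * `|x|.

Definition null_solution (w w' : R -> X) :=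
  [/\ forall t : R, 0 < t -> is_derive t 1 w (w' t),
      forall t : R, 0 < t -> E (w' t) + A (w t) = 0
    & w t @[t --> (0:R)^'+] --> 0].

Lemma null_solution_resolventE w w' : null_solution w w' ->
  null_solution (S \o E \o w) (S \o E \o w').
Proof.
move=> [dw eqw w0]; split=> [t t0|t t0|] /=.
- exact: (is_derive_linear S_cont (is_derive_linear E_cont (dw t t0))).
- by rewrite (A_resolvent_comm SK KS) -!linearD/= eqw// !linear0.
- rewrite -(linear0 S) -(linear0 E).
  apply: continuous_cvg; first exact: S_cont.
  by apply: continuous_cvg; first exact: E_cont.
Qed.

(** If [S E w = 0] then [S E w' = 0] too, so applying [S] to the equation gives
[S A w = 0], and [w = s S E w + S A w]. *)
Lemma null_solution_inj w w' : null_solution w w' ->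
  (forall t : R, 0 < t -> S (E (w t)) = 0) -> forall t : R, 0 < t -> w t = 0.
Proof.
move=> sw Pw t t0; have [dP _ _] := null_solution_resolventE sw.
have [_ eqw _] := sw.
have dP0 : S (E (w' t)) = 0.
  have /is_derive1P dPt := dP t t0.
  apply: cvg_unique dPt _ => //; apply: cvg_near_cst; near=> h.
  rewrite /= !Pw ?subrr ?scaler0//.
  by near: h; exact: near0_add_gt0.
have SA0 : S (A (w t)) = 0.
  by rewrite -[S _]add0r -dP0 -!linearD/= eqw// linear0.
by have := scale_resolventE SK (w t); rewrite SA0 subr0 Pw// scaler0.
Unshelve. all: by end_near. Qed.

(** [w'] is a limit of difference quotients, so it stays in the closed space, where
the equation bounds it by [w]. *)
Lemma null_solution_consistent w w' : null_solution w w' ->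
  (forall t : R, 0 < t -> consistent E A k (w t)) ->
  forall t : R, 0 < t -> w t = 0.
Proof.
move=> [dw eqw w0] Vw; apply: (gronwall_zero norm2_line dw _ w0) => t t0.
apply: flow_bounded => //; first exact: Vw; last exact: eqw.
have /is_derive1P dwt := dw t t0.
apply: (closed_cvg _ Vk_closed _ _ dwt); near=> h.
have Vs := consistent_subspace E A k.
apply: subspaceZ => //; apply: subspaceB => //; apply: Vw => //.
by near: h; exact: near0_add_gt0.
Unshelve. all: by end_near. Qed.

(** Descending induction on the space that contains [w], replacing [w] by [S E w]
to reach [consistent E A k]. *)
Theorem null_solution_eq0 w w' : null_solution w w' ->
  forall t : R, 0 < t -> w t = 0.
Proof.
suff H j : forall w w', null_solution w w' ->
    (forall t : R, 0 < t -> consistent E A (k - j) (w t)) ->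
    forall t : R, 0 < t -> w t = 0.
  by move=> sw; apply: (H k _ _ sw) => t _; rewrite subnn.
elim: j => [|j IH] {}w {}w' sw Vw.
  by apply: null_solution_consistent sw _; rewrite subn0 in Vw.
apply: null_solution_inj (sw) _; apply: IH (null_solution_resolventE sw) _.
move=> t t0 /=; have [jk|kj] := ltnP j k; last first.
  by move: kj; rewrite -subn_eq0 => /eqP ->.
by have := resolventE_consistent KS (Vw t t0); rewrite subnS prednK// subn_gt0.
Qed.

End uniqueness.
End cauchy_problem.

(** * Regular pencils: the bounded generator *)

(** The growth condition is sampled along real points [s n] of the resolvent set
that tend to infinity, with [S n] the inverse of [s n E + A]. *)
Section regular.
Context {R : realType} {X : completeNormedModType R}.
Variables (E A : {linear X -> X}).
Local Notation V := (consistent E A).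
Variables (a e : R) (k : nat) (s : nat -> R) (S : nat -> {linear X -> X}).
Hypothesis A_bounded : forall x, `|A x| <= a * `|x|.
Hypothesis E_bounded : forall x, `|E x| <= e * `|x|.
Hypothesis s_ge1 : forall n, 1 <= s n.
Hypothesis s_oo : (s n)^-1 @[n --> \oo] --> 0.
Hypothesis SK : forall n x, S n (s n *: E x + A x) = x.
Hypothesis KS : forall n y, s n *: E (S n y) + A (S n y) = y.
Hypothesis S_growth : exists C, forall n y, `|S n y| <= C * s n ^+ k * `|y|.
Hypothesis Y_closed : closed (E @` V k).
Local Notation Y := (E @` V k).

Let s_gt0 n : 0 < s n. Proof. exact: lt_le_trans (s_ge1 n). Qed.

Let A_cont : continuous A. Proof. exact: norm_bounded_continuous A_bounded. Qed.
Let E_cont : continuous E. Proof. exact: norm_bounded_continuous E_bounded. Qed.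

(** [s S(s) A x = s S(s) E y = y - S(s) A y] when [A x = E y], so the exponent
drops by one with each step. *)
Lemma resolvent_growth_consistent j x : (j <= k)%N -> V j x ->
  exists c, forall n, `|S n (A x)| <= c * s n ^+ (k - j).
Proof.
elim: j x => [|j IH] x jk Vx.
  have [C SC] := S_growth; exists (C * `|A x|) => n.
  by rewrite mulrAC subn0.
have [y Vy <-] := Vx; have [c yc] := IH y (ltnW jk) Vy.
exists (`|y| + c) => n.
rewrite -(ler_pM2l (s_gt0 n)) -[X in X * `|_|]gtr0_norm// -normrZ.
rewrite (scale_resolventE (SK n)) (le_trans (ler_normB _ _))//.
rewrite mulrCA -exprS -subSn// subSS mulrDl lerD//.
by rewrite ler_peMr// exprn_ege1.
Qed.

Lemma scaled_resolvent_ptbounded y : Y y ->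
  exists M, forall n, `|(s n \*: S n) y| <= M.
Proof.
move=> [x Vx <-]; have [c xc] := resolvent_growth_consistent (leqnn k) Vx.
exists (`|x| + c) => n /=; rewrite (scale_resolventE (SK n)).
by rewrite (le_trans (ler_normB _ _))// lerD// (le_trans (xc n))// subnn mulr1.
Qed.

Lemma scaled_resolvent_bounded :
  exists M, forall n y, Y y -> `|(s n \*: S n) y| <= M * `|y|.
Proof.
apply: uniform_boundedness => //.
- exact: image_consistent_subspace.
- move=> n; have [C SC] := S_growth.
  apply: (@norm_bounded_continuous _ _ _ _ (s n * (C * s n ^+ k))) => x /=.
  by rewrite normrZ gtr0_norm// -mulrA ler_wpM2l// ltW.
- exact: scaled_resolvent_ptbounded.
Qed.

Lemma resolvent_cvg0 y : Y y -> S n y @[n --> \oo] --> 0.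
Proof.
move=> /scaled_resolvent_ptbounded[M yM].
apply/norm_cvg0P; apply: (@squeeze_cvgr _ _ _ _ (fun=> 0) (fun n => (s n)^-1 * M)).
- apply: nearW => n; rewrite normr_ge0/= mulrC ler_pdivlMr// mulrC.
  by rewrite -[X in X * `|_|]gtr0_norm// -normrZ yM.
- exact: cvg_cst.
- by rewrite -[X in _ --> X](mul0r M); apply: cvgM => //; exact: cvg_cst.
Qed.

Lemma scaled_resolventE_cvg x : V k.+1 x -> s n *: S n (E x) @[n --> \oo] --> x.
Proof.
move=> Yx; under eq_fun do rewrite (scale_resolventE (SK _)).
suff : x - S n (A x) @[n --> \oo] --> x - 0 by rewrite subr0.
apply: cvgB; first exact: cvg_cst.
exact: resolvent_cvg0.
Qed.

(** [E x = 0] makes the sequence of [scaled_resolventE_cvg], whose limit is [x],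
vanish. *)
Lemma E_inj_consistent x : V k.+1 x -> E x = 0 -> x = 0.
Proof.
move=> /scaled_resolventE_cvg + Ex; rewrite Ex => xl; apply/esym; apply: cvg_unique xl => //.
rewrite /=; under eq_fun do rewrite linear0 scaler0; exact: cvg_cst.
Qed.

Lemma consistent_closed : closed (V k.+1).
Proof. by apply: preimage_closed => // x _; exact: A_cont. Qed.

(** The preimage of [y] is the limit of [w n = s n S(s n) y]. These points lie in
[V k.+1] and their images tend to [y], so the convergence of [w] follows from
the one already known on [E (V k.+1)] and uniform boundedness. *)
Lemma E_solvable :
  exists2 M, 0 <= M & forall y, Y y -> exists2 x, V k.+1 x & E x = y /\ `|x| <= M * `|y|.
Proof.
have [M TM] := scaled_resolvent_bounded.
exists `|M| => // y Yy; have Ys := image_consistent_subspace E A k.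
have [x0 Vx0 Ex0] := Yy.
pose w n := s n *: S n y.
have Vw n : V k.+1 (w n).
  apply: subspaceZ; first exact: consistent_subspace.
  by rewrite -Ex0; exact: (resolventE_consistent (KS n) Vx0).
have Ew : E (w n) @[n --> \oo] --> y.
  have -> : (fun n => E (w n)) = (fun n => y - A (S n y)).
    by apply/funext => n; rewrite /w linearZ/=; apply/(canRL (addrK _))/KS.
  suff : y - A (S n y) @[n --> \oo] --> y - 0 by rewrite subr0.
  apply: cvgB; first exact: cvg_cst.
  rewrite -(linear0 A); apply: continuous_cvg; first exact: A_cont.
  exact: resolvent_cvg0.
have : cvg (w n @[n --> \oo]).
  apply: (cvg_from_dense Ys TM _ Ew Yy) => m.
    by exists (w m) => //; exact: consistent_decr.
  by apply/cvg_ex; exists (w m); exact: scaled_resolventE_cvg.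
move=> /cvg_ex[x wx]; exists x.
  by apply: (closed_cvg _ consistent_closed _ _ wx); exact: nearW.
split.
  apply: cvg_unique Ew => //.
  by apply: continuous_cvg => //; exact: E_cont.
apply: cvg_norm_le wx _; apply: nearW => n.
by rewrite (le_trans (TM n y Yy))// ler_wpM2r// ler_norm.
Qed.

(** [y] is the value at [x] of the generator [- E^-1 A]; iterating it produces the
orbit that the exponential series sums. *)
Lemma flow_generator : exists2 b, 0 <= b & forall x, V k.+1 x ->
  exists2 y, V k.+1 y & E y = - A x /\ `|y| <= b * `|x|.
Proof.
have [M M0 EM] := E_solvable.
exists (M * `|a|) => [|x Zx]; first by rewrite mulr_ge0.
have [|y Zy [Ey yM]] := EM (- A x).
  by rewrite -scaleN1r; apply: subspaceZ => //; exact: image_consistent_subspace.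
exists y => //; split => //; rewrite (le_trans yM)// -mulrA ler_wpM2l// normrN.
by rewrite (le_trans (A_bounded x))// ler_wpM2r// ler_norm.
Qed.

Lemma regular_cauchy_existence u0 : V k.+1 u0 -> exists u u' : R -> X,
  [/\ forall t : R, is_derive t 1 u (u' t), continuous u',
      u t @[t --> (0:R)^'+] --> u0 & forall t : R, E (u' t) + A (u t) = 0].
Proof.
move=> Zu0; have [b b0 genP] := flow_generator.
have [f fP] : {f : X -> X & forall x, V k.+1 x ->
    [/\ V k.+1 (f x), E (f x) = - A x & `|f x| <= b * `|x|]}.
  apply: (@choice _ _ (fun x y => V k.+1 x -> [/\ V k.+1 y, E y = - A x & `|y| <= b * `|x|])).
  move=> x; have [Zx|nZx] := pselect (V k.+1 x); last by exists x.
  by have [y Zy [Ey yb]] := genP x Zx; exists y.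
pose x n := iter n f u0.
have Zx n : V k.+1 (x n) by elim: n => [//|n IH]; case: (fP _ IH).
have xb n : `|x n| <= `|u0| * b ^+ n.
  elim: n => [|n IH]; first by rewrite expr0 mulr1.
  have [_ _ /le_trans -> //] := fP _ (Zx n).
  by rewrite exprS mulrCA ler_wpM2l.
have xSb n : `|x n.+1| <= `|u0| * b * b ^+ n by rewrite -mulrA -exprS.
have xr n : E (x n.+1) = - A (x n) by case: (fP _ (Zx n)).
exists (exp_sum x), (exp_sum (fun n => x n.+1)); split.
- by move=> t; exact: is_derive_exp_sum xb.
- move=> t; have [d _] := is_derive_exp_sum t b0 xSb.
  by apply: differentiable_continuous; apply/derivable1_diffP.
- exact: exp_sum_cvg_at_right0 xb.
- exact: exp_sum_solves xb xr.
Qed.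

Lemma regular_cauchy_uniqueness :
  quadratic_norm X ->
  forall w w' : R -> X, null_solution E A w w' -> forall t : R, 0 < t -> w t = 0.
Proof.
move=> norm2_line w w' sw; have [b _ genP] := flow_generator.
have [C SC] := S_growth.
apply: (null_solution_eq0 E_cont norm2_line _ (SK 0) (KS 0) _ _ sw).
- exact: norm_bounded_continuous (SC 0%N).
- exact: consistent_closed.
- move=> x y Zx Zy Exy; have [z Zz [Ez zb]] := genP x Zx.
  suff -> : y = z by exact: zb.
  apply/eqP; rewrite -subr_eq0; apply/eqP.
  apply: E_inj_consistent.
    by apply: subspaceB => //; exact: consistent_subspace.
  by rewrite linearB Ez opprK.
Qed.

End regular.

(** * From the complex Hilbert space to its realification *)

Section realification.
Context {R : realType} {H : completeNormedModType R[i]}.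
Local Notation X := (realified R H).

Fact realified_is_linear (T : H -> H) : linear T ->
  linear (T : X -> X).
Proof. by move=> Tl r x y; exact: (Tl r%:C x y). Qed.

Definition realified_linear (T : H -> H) (Tl : linear T) : {linear X -> X} :=
  HB.pack (T : X -> X)
    (GRing.isLinear.Build R X X *:%R (T : X -> X) (realified_is_linear Tl)).

Lemma IV_consistent (E A : H -> H) j : IV E A j = consistent E A j.
Proof. by elim: j => //= j ->. Qed.

(** Boundedness makes the supremum in [opnorm] a genuine one. *)
Lemma rnorm_le_opnorm (T : H -> H) : linear T -> bounded_op T ->
  forall x, rnorm (T x) <= opnorm T * rnorm x.
Proof.
move=> Tl [M TM] x.
have T0 : (T : X -> X) 0 = 0 by exact: (linear0 (realified_linear Tl)).
have [x0|x0] := eqVneq (x : X) 0.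
  by rewrite x0 T0 /rnorm normr0 mulr0.
have nx : 0 < rnorm x by rewrite /rnorm normr_gt0.
have := realified_is_linear Tl (rnorm x)^-1 x 0.
rewrite T0 !addr0 => Tx.
rewrite -ler_pdivrMr//.
have -> : rnorm (T x) / rnorm x = rnorm (T ((rnorm x)^-1 *: (x : X))).
  by rewrite Tx /rnorm normrZ gtr0_norm ?invr_gt0// mulrC.
apply: ub_le_sup.
  exists `|M| => _ [y /= y1 <-]; apply: le_trans (TM y) _.
  rewrite (le_trans (ler_wpM2r _ (ler_norm M)))//; first exact: normr_ge0.
  by rewrite ler_piMr.
exists ((rnorm x)^-1 *: (x : X)) => //=.
by rewrite /rnorm normrZ gtr0_norm ?invr_gt0// mulVf// gt_eqF.
Qed.

Lemma dot_norm2_line (dot : {dot H for Num.conj}) :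
  (forall x : H, `|x| ^+ 2 = dot x x) ->
  quadratic_norm X.
Proof.
move=> nd x y r.
have nE (z : X) : `|z|%:C * `|z|%:C = dot z z by rewrite -nd rnormE.
apply: complexI; rewrite !(rmorphN, rmorphD, rmorphM)/= !nE.
have -> : x + r *: y = (x : H) + r%:C *: (y : H) by [].
have -> : (x + y : X) = (x : H) + (y : H) by [].
rewrite !linearDl !linearDr !linearZl_LR !linearZr_LR /=.
have -> : Num.conj (r%:C : R[i]) = r%:C by exact: conjc_real.
rewrite [r%:C *: (_ * _)]/GRing.scale/=; ring.
Qed.

End realification.

Lemma real_resolvent (R : realType) (H : completeNormedModType R[i])
    (E A : {linear H -> H}) (r : R) : resolvent_set E A r%:C ->
  exists S : {linear realified R H -> realified R H},
    [/\ forall x : realified R H, S (r *: (E x : realified R H) + A x) = x,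
        forall y : realified R H, r *: (E (S y) : realified R H) + A (S y) = y
      & forall y, `|S y| <= opnorm (pencil_inv E A r%:C) * `|y|].
Proof.
move=> [bij lin bnd]; exists (realified_linear lin); split => [x|y|y].
- apply: (pinvKV _ (A := [set: H]) (f := pencil E A r%:C)); last by rewrite inE.
  by move=> ? ? _ _; exact: bij_inj.
- have [g _ gK] := bij.
  by apply: (pinvK _ (A := [set: H]) (f := pencil E A r%:C)); rewrite inE; exists (g y).
- exact: rnorm_le_opnorm lin bnd y.
Qed.

Theorem theorem1p3 (R : realType) (H : completeNormedModType R[i])
    (dot : {dot H for Num.conj})
    (norm_dot : forall x : H, `|x| ^+ 2 = dot x x)
    (E A : {linear H -> H}) (E_bounded : bounded_op E) (A_bounded : bounded_op A)
    (nu0 : R) (EA_regular : regular_at E A nu0)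
    (range_closed : closed (E @` IV E A (ind E A nu0)))
    (u0 : H) (u0_IV : IV E A (ind E A nu0).+1 u0) :
  exists u : R -> realified R H,
    is_solution E A u0 u /\
    forall v : R -> realified R H, is_solution E A u0 v ->
      forall t : R, 0 < t -> v t = u t.
Proof.
have [half_plane _] := EA_regular.
have [[C C0 growth] _] := indP EA_regular.
move: (ind E A nu0) range_closed u0_IV growth => k range_closed u0_IV growth.
pose X := realified R H.
pose Er : {linear X -> X} := realified_linear (linearP E).
pose Ar : {linear X -> X} := realified_linear (linearP A).
have [e eE] : exists e : R, forall x : X, `|Er x| <= e * `|x| by exact: E_bounded.
have [a aA] : exists a : R, forall x : X, `|Ar x| <= a * `|x| by exact: A_bounded.
(* The shift puts [s n] to the right of [nu0] and makes [s n >= n + 1]. *)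
pose s n : R := n%:R + Num.max 1 (nu0 + 1).
have s1 n : n.+1%:R <= s n by rewrite /s -natr1 lerD2l le_max lexx.
have s_nu n : nu0 < s n.
  rewrite /s (@lt_le_trans _ _ (Num.max 1 (nu0 + 1)))//; last by rewrite lerDr.
  by rewrite lt_max [nu0 < nu0 + 1]ltrDl ltr01 orbT.
have s_ge1 n : 1 <= s n by rewrite (le_trans _ (s1 n))// ler1n.
have s_oo : (s n)^-1 @[n --> \oo] --> (0 : R).
  apply: (@squeeze_cvgr _ _ _ _ (fun=> 0) harmonic); last exact: cvg_harmonic.
    apply: nearW => n; rewrite invr_ge0 (le_trans ler01 (s_ge1 n))/=.
    by rewrite lef_pV2 ?posrE// (lt_le_trans ltr01 (s_ge1 n)).
  exact: cvg_cst.
have [S SP] := choice (fun n =>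
  real_resolvent (half_plane _ (s_nu n : right_half_plane nu0 (s n)%:C))).
have SK n : forall x, S n (s n *: Er x + Ar x) = x by case: (SP n).
have KS n : forall y, s n *: Er (S n y) + Ar (S n y) = y by case: (SP n).
have S_growth : exists C, forall n y, `|S n y| <= C * s n ^+ k * `|y|.
  exists C => n y; have [_ _ /(_ y) /le_trans] := SP n; apply.
  rewrite ler_wpM2r//; have := growth _ (s_nu n : right_half_plane nu0 (s n)%:C).
  have -> : `|((s n)%:C : Rcomplex R)| = s n; last by [].
  by rewrite -[LHS]/(Num.sqrt (s n ^+ 2 + 0 ^+ 2)) expr0n addr0 sqrtr_sqr ger0_norm// (le_trans ler01).
have Y_closed : closed (Er @` consistent Er Ar k).
  by rewrite -[consistent _ _ _]/(consistent E A k) -IV_consistent.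
have Zu0 : consistent Er Ar k.+1 u0.
  by rewrite -[consistent _ _ _]/(consistent E A k.+1) -IV_consistent.
have [u [u' [du cu' u00 equ]]] :=
  regular_cauchy_existence aA eE s_ge1 s_oo SK KS S_growth Y_closed Zu0.
have u'E : derive1 u = u'.
  by apply/funext => t; rewrite derive1E; have [_ ->] := du t.
exists u; split.
  split=> // [t t0|t t0]; rewrite u'E.
    by split; [have [] := du t|exact: cu'].
  exact: equ.
move=> v [dv v0 eqv] t t0; apply/eqP; rewrite -subr_eq0; apply/eqP.
apply: (regular_cauchy_uniqueness aA eE s_ge1 s_oo SK KS S_growth Y_closed
  (dot_norm2_line norm_dot) (w := fun t => v t - u t) (w' := fun t => derive1 v t - u' t)) t0.
split=> [r r0|r r0|].
- apply: is_deriveB.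
  by rewrite derive1E; apply: derivableP; case: (dv r r0).
- by rewrite !linearB addrACA -opprD equ subr0; exact: eqv.
- by rewrite -(subrr (u0 : X)); apply: cvgB.
Qed.
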